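(* Let $P\subset\mathbb{R}^n$ be a Delone set of finite local complexity, $\varphi:\mathbb{R}^n\to\mathbb{R}^n$ a continuous function and $g\in GL(n,\mathbb{R})$. Suppose that $\varphi-g$ is weakly $P$-equivariant (as a $C^0$-function). Define $\Phi_g:\mathrm{orb}(P)\to\Omega_{\varphi(P)}$ by $\Phi_g(P-x)=\varphi(P)-g(x)$. Then $\Phi_g$ is a uniformly continuous map (with respect to the metric $D$), which therefore extends continuously to $\Omega_P$, and which satisfies $\Phi_g(\omega-x)=\Phi_g(\omega)-g(x)$ for all $\omega\in\Omega_P$, $x\in\mathbb{R}^n$. In particular, if $g=\mathrm{id}$, then $\Phi_{\mathrm{id}}$ extends to a topological semi-conjugacy between $(\Omega_P,\mathbb{R}^n)$ and $(\Omega_{\varphi(P)},\mathbb{R}^n)$ mapping $P$ to $\varphi(P)$. If $\varphi-g$ is even strongly $P$-equivariant, then $\varphi(P)$ is a Delone set.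
   Context: $B(x,r)$ is the open ball in $\mathbb{R}^n$ and, for a closed set $P\subset\mathbb{R}^n$, $B_r[P]=B(0,r)\cap P$. $P$ is uniformly discrete if $\inf\{|x-y| : x\neq y\in P\}>0$, relatively dense if there is $r$ such that $B_r[P-x]\ne\emptyset$ for all $x\in\mathbb{R}^n$, and Delone if both. $P$ has finite local complexity if for every $r$ there are only finitely many distinct sets $B_r[P-x]$, $x\in P$. On closed subsets of $\mathbb{R}^n$ put $D(P,Q)=\inf\{\epsilon>0 : d_H(B_{1/\epsilon}[P]\cup\partial B(0,1/\epsilon),\,B_{1/\epsilon}[Q]\cup\partial B(0,1/\epsilon))\le\epsilon\}$, $d_H$ being the Hausdorff distance. $\Omega_P$ is the completion of $\mathrm{orb}(P)=\{P-x : x\in\mathbb{R}^n\}$ with respect to $D$; it is compact and carries the continuous $\mathbb{R}^n$-action $\omega\mapsto\omega-x$ extending translation. A function $f$ on $\mathbb{R}^n$ is strongly $P$-equivariant if there is a finite $R$ such that for all $x,y\in\mathbb{R}^n$, $B_R[P-x]=B_R[P-y]$ implies $f(x)=f(y)$. A continuous function $f:\mathbb{R}^n\to\mathbb{R}^m$ is weakly $P$-equivariant (as a $C^0$-function) if for every $\epsilon>0$ there is a continuous strongly $P$-equivariant $f_\epsilon$ with $\sup_x|f(x)-f_\epsilon(x)|<\epsilon$. A topological semi-conjugacy between $(\Omega_P,\mathbb{R}^n)$ and $(\Omega_{Q},\mathbb{R}^n)$ is a continuous surjection $\Omega_P\to\Omega_{Q}$ commuting with the $\mathbb{R}^n$-actions.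 The map $\Phi_g$ is well defined, i.e. $\varphi(P)-g(x)$ depends only on $P-x$. *)

(* Defs.v *)
From HB Require Import structures.
From mathcomp Require Import all_boot all_order all_algebra.
From mathcomp Require Import all_classical all_reals all_analysis.
Set Implicit Arguments.
Unset Strict Implicit.
Unset Printing Implicit Defensive.
Import Order.TTheory GRing.Theory Num.Theory numFieldNormedType.Exports.
Local Open Scope classical_set_scope.
Local Open Scope ring_scope.

(* The library norm on matrices is the sup norm, hence a separate Euclidean
   norm; the two induce the same topology on 'cV[R]_n. *)
Definition enorm (R : realType) (n : nat) (x : 'cV[R]_n) : R :=
  Num.sqrt (\sum_(i < n) x i ord0 ^+ 2).

Section PointSets.
Context {R : realType} {n : nat}.
Notation V := ('cV[R]_n).
Implicit Types (P Q : set V) (x y : V) (r : R).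

Definition eball x r : set V := [set y | enorm (y - x) < r].

Definition esphere r : set V := [set y | enorm y = r].

(* P - x *)
Definition translate P x : set V := [set p - x | p in P].

(* B_r[P] *)
Definition patch r P : set V := eball 0 r `&` P.

(* The infimum is taken in the extended reals, so that it is +oo when P has at
   most one point. *)
Definition uniformly_discrete P : Prop :=
  (0 < ereal_inf [set d : \bar R | exists x y : V,
        [/\ P x, P y, x != y & d = (enorm (x - y))%:E]])%E.

Definition relatively_dense P : Prop :=
  exists r, forall x, patch r (translate P x) !=set0.

Definition Delone P : Prop := uniformly_discrete P /\ relatively_dense P.

Definition finite_local_complexity P : Prop :=
  forall r, finite_set [set patch r (translate P x) | x in P].

Definition hausdorff_dist (A B : set V) : \bar R :=
  maxe
    (ereal_sup [set ereal_inf [set (enorm (a - b))%:E | b in B] | a in A])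
    (ereal_sup [set ereal_inf [set (enorm (a - b))%:E | a in A] | b in B]).

Definition hull_dist P Q : R :=
  inf [set e : R | 0 < e /\
    (hausdorff_dist (patch e^-1 P `|` esphere e^-1)
                    (patch e^-1 Q `|` esphere e^-1) <= e%:E)%E].

Definition strongly_equivariant (m : nat) P (f : V -> 'cV[R]_m) : Prop :=
  exists r, forall x y,
    patch r (translate P x) = patch r (translate P y) -> f x = f y.

Definition weakly_equivariant (m : nat) P (f : V -> 'cV[R]_m) : Prop :=
  continuous f /\
  forall eps : R, 0 < eps -> exists g : V -> 'cV[R]_m,
    [/\ continuous g, strongly_equivariant P g &
        (ereal_sup (range (fun x => (enorm (f x - g x))%:E)) < eps%:E)%E].

Definition orb P : set (set V) := range (translate P).

Definition orb_pt P x : orb P :=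
  exist _ (translate P x) (mem_set (imageT (translate P) x)).

Lemma translate0 P : translate P 0 = P.
Proof.
rewrite /translate; apply/seteqP; split => [_ [p Pp <-]|p Pp].
  by rewrite subr0.
by exists p => //; rewrite subr0.
Qed.

Lemma translateD P x y : translate (translate P x) y = translate P (x + y).
Proof.
rewrite /translate; apply/seteqP; split => [_ [_ [p Pp <-] <-]|_ [p Pp <-]].
  by exists p => //; rewrite opprD addrA.
by exists (p - x); [exists p|rewrite opprD addrA].
Qed.

Lemma orb_self P : orb P P.
Proof. by exists 0 => //; exact: translate0. Qed.

Lemma orb_translate P (A : set V) x : orb P A -> orb P (translate A x).
Proof. by move=> [y _ <-]; exists (y + x) => //; rewrite translateD. Qed.

(* P and A - x as points of orb(P) *)
Definition orb_base P : orb P := exist _ P (mem_set (orb_self P)).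

Definition orb_shift P (A : orb P) x : orb P :=
  exist _ (translate (sval A) x)
    (mem_set (orb_translate x (set_mem (svalP A)))).

End PointSets.

(* A completion of (X, d): a complete metric space with an isometric map from X
   whose image is dense. It is unique up to a unique isometry over X. *)
Record completion (R : realType) (X : Type) (d : X -> X -> R) := Completion {
  completion_sort :> metricType R;
  completion_in : X -> completion_sort;
  completion_isometry :
    forall a b, mdist (completion_in a) (completion_in b) = d a b;
  completion_dense : dense (range completion_in);
  completion_complete : forall F : set_system completion_sort,
    ProperFilter F -> cauchy F -> exists l : completion_sort, F --> l
}.
Arguments completion_in {R X d} c _.

Section Hull.
Context {R : realType} {n : nat}.
Notation V := ('cV[R]_n).
Implicit Types (P Q : set V).

(* Omega_P, as a completion of orb(P) for D *)
Definition hull P : Type :=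
  completion (fun A B : orb P => hull_dist (sval A) (sval B)).

Definition hull_in P (O : hull P) : orb P -> O := @completion_in _ _ _ O.

(* w - x is the value at w of the extension by continuity of A |-> A - x from
   orb(P) to Omega_P, that is, the limit of A - x as A in orb(P) tends to w.
   This limit exists for closed P, so the default value w plays no role. *)
Definition hull_act P (O : hull P) (w : O) (x : V) : O :=
  xget w [set w' : O |
    (fun A : orb P => hull_in O (orb_shift A x))
      @ filter_from (nbhs w) (fun U => hull_in O @^-1` U) --> w'].

Definition orb_unif_continuous P Q (O : hull Q) (Phi : orb P -> O) : Prop :=
  forall eps : R, 0 < eps -> exists2 delta : R, 0 < delta &
    forall A B : orb P, hull_dist (sval A) (sval B) < delta ->
      mdist (Phi A) (Phi B) < eps.

Definition semi_conjugacy P Q (O : hull P) (O' : hull Q) (F : O -> O') : Prop :=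
  [/\ continuous F,
      forall w' : O', exists w : O, F w = w' &
      forall (w : O) (x : V), F (hull_act w x) = hull_act (F w) x].

End Hull.

(* Main.v *)
From Pilot Require Import Defs.
From HB Require Import structures.
From mathcomp Require Import all_boot all_order all_algebra finmap.
From mathcomp Require Import all_classical all_reals all_analysis.
From mathcomp Require Import lra ring.
Import Pilot.Defs.
Set Implicit Arguments.
Unset Strict Implicit.
Unset Printing Implicit Defensive.
Import Order.TTheory GRing.Theory Num.Theory numFieldNormedType.Exports.
Local Open Scope classical_set_scope.
Local Open Scope ring_scope.

(** Write [phi x = g x + h x].  The proof replaces the distance between point sets
    by local closeness: [A] and [B] are near each other when, inside a large ball,
    every point of either set is near a point of the other
    ([close_of_hull_dist], [hull_dist_le_of_close]).

    If [P - x] and [P - y] are close, then by finite local complexity they agree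
    exactly on a large ball after a small translation [s] of one of them
    ([hull_dist_patch_eq]): around points of [P] only finitely many patches occur,
    so patches that are close enough coincide.  A weakly equivariant [h] then takes
    nearly equal values at corresponding points of [P], as equal patches of a
    large radius force nearly equal values.  Hence a point
    [g (p - x) + h p] of [phi(P) - g x] is near the point [g (p' - y) + h p'] of
    [phi(P) - g y] with [p'] the point corresponding to [p], the error being
    [g s] plus a difference of values of [h] ([image_approx]).  That [h] is bounded
    and [g] is invertible bounds [p - x] in terms of the norm of the image point, so
    agreement of patches up to a finite radius suffices.  This is the uniform
    continuity of [P - x |-> phi(P) - g x] ([image_hull_dist]); its case of distance
    zero says that the map is well defined.

    A uniformly continuous map into a complete space extends to the completion, as
    its limit along the traces of neighbourhoods ([unif_cvg_trace],
    [unif_lim_continuous], [unif_lim_extends]).  The action on a hull is such a limit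
    too, so it is continuous, and the equivariance of the extension need only be
    checked on the orbit, where it is [g (x + y) = g x + g y].

    Surjectivity is a compactness argument.  Along any ultrafilter on the vectors
    [x] the sets [P - x] converge in the hull of [P] ([orbit_ultra_cvg]).  Given a
    point of the hull of [phi(P)], an ultrafilter along which [phi(P) - g x]
    converges to it yields a preimage.

    If [h] is strongly equivariant, it takes finitely many values on [P]; the
    differences [phi p - phi q] of norm less than [1] then form a finite set, which
    gives uniform discreteness ([image_uniformly_discrete]).  Relative density
    follows from the boundedness of [h]. *)

(** * The Euclidean norm *)

Section EuclideanNorm.
Context {R : realType}.

Lemma enorm_ge0 n (x : 'cV[R]_n) : 0 <= enorm x.
Proof. exact: sqrtr_ge0. Qed.

Lemma sqr_enorm n (x : 'cV[R]_n) : enorm x ^+ 2 = \sum_(i < n) x i ord0 ^+ 2.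
Proof. by rewrite sqr_sqrtr// sumr_ge0// => i _; exact: sqr_ge0. Qed.

Lemma le_coord_enorm n (x : 'cV[R]_n) i : `|x i ord0| <= enorm x.
Proof.
rewrite -sqrtr_sqr ler_wsqrtr// (bigD1 i)//= lerDl sumr_ge0// => j _.
exact: sqr_ge0.
Qed.

Lemma enorm_eq0 n (x : 'cV[R]_n) : enorm x = 0 -> x = 0.
Proof.
move=> x0; apply/colP => i; apply/eqP; rewrite mxE -normr_le0 -x0.
exact: le_coord_enorm.
Qed.

Lemma enorm0 n : enorm (0 : 'cV[R]_n) = 0.
Proof. by rewrite /enorm big1 ?sqrtr0// => i _; rewrite mxE expr0n. Qed.

Lemma enormN n (x : 'cV[R]_n) : enorm (- x) = enorm x.
Proof. by congr Num.sqrt; apply: eq_bigr => i _; rewrite mxE sqrrN. Qed.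

Lemma enormB n (x y : 'cV[R]_n) : enorm (x - y) = enorm (y - x).
Proof. by rewrite -enormN opprB. Qed.

Lemma enormZ n (a : R) (x : 'cV[R]_n) : enorm (a *: x) = `|a| * enorm x.
Proof.
rewrite /enorm -sqrtr_sqr -sqrtrM ?sqr_ge0// mulr_sumr; congr Num.sqrt.
by apply: eq_bigr => i _; rewrite mxE exprMn.
Qed.

(** Cauchy-Schwarz, in the form of the sum over the coordinates of
    [0 <= (b x_i - a y_i)^2] with [a] and [b] the norms of [x] and [y]. *)
Lemma dot_le_enorm n (x y : 'cV[R]_n) :
  \sum_(i < n) x i ord0 * y i ord0 <= enorm x * enorm y.
Proof.
have [/enorm_eq0->|x0] := eqVneq (enorm x) 0.
  by rewrite enorm0 mul0r big1// => i _; rewrite mxE mul0r.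
have [/enorm_eq0->|y0] := eqVneq (enorm y) 0.
  by rewrite enorm0 mulr0 big1// => i _; rewrite mxE mulr0.
have xy0 : 0 < enorm x * enorm y by rewrite mulr_gt0// lt0r ?x0 ?y0 enorm_ge0.
have : 0 <= \sum_(i < n) (enorm y * x i ord0 - enorm x * y i ord0) ^+ 2.
  by apply: sumr_ge0 => i _; exact: sqr_ge0.
rewrite (eq_bigr (fun i => enorm y ^+ 2 * x i ord0 ^+ 2
   + (enorm x ^+ 2 * y i ord0 ^+ 2
   + (- (2 * (enorm x * enorm y))) * (x i ord0 * y i ord0)))); last first.
  by move=> i _; ring.
rewrite !big_split/= -!mulr_sumr -!sqr_enorm => h.
rewrite -(ler_pM2l xy0); nra.
Qed.

Lemma enormD n (x y : 'cV[R]_n) : enorm (x + y) <= enorm x + enorm y.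
Proof.
rewrite -(@ler_pXn2r _ 2)// ?nnegrE ?addr_ge0 ?enorm_ge0// sqrrD !sqr_enorm.
rewrite (eq_bigr (fun i => x i ord0 ^+ 2 + (y i ord0 ^+ 2
   + 2 * (x i ord0 * y i ord0)))); last by move=> i _; rewrite mxE; ring.
rewrite !big_split/= -mulr_sumr; have := dot_le_enorm x y; lra.
Qed.

Lemma enorm_triangle n (y x z : 'cV[R]_n) :
  enorm (x - z) <= enorm (x - y) + enorm (y - z).
Proof. by rewrite (_ : x - z = (x - y) + (y - z)) ?enormD// addrA subrK. Qed.

Lemma enorm_leD n (x y : 'cV[R]_n) : enorm x <= enorm y + enorm (x - y).
Proof. by rewrite -{1}[x](subrKC y) enormD. Qed.

Lemma le_normr_enorm n (x : 'cV[R]_n) : `|x| <= enorm x.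
Proof.
rewrite [leLHS]/Num.norm/= mx_normrE; apply/bigmax_leP; split=> [|[i j] _].
  exact: enorm_ge0.
by rewrite (ord1 j)/= le_coord_enorm.
Qed.

Lemma le_coord_normr n (x : 'cV[R]_n) i : `|x i ord0| <= `|x|.
Proof.
rewrite [leRHS]/Num.norm/= mx_normrE; apply/bigmax_geP; right.
by exists (i, ord0).
Qed.

Lemma enorm_le_normr n (x : 'cV[R]_n) : enorm x <= Num.sqrt n%:R * `|x|.
Proof.
rewrite -[ `|x| ]ger0_norm// -sqrtr_sqr -sqrtrM// ler_wsqrtr//.
have -> : n%:R * `|x| ^+ 2 = \sum_(i < n) `|x| ^+ 2.
  by rewrite sumr_const card_ord mulr_natl.
rewrite ler_sum// => i _.
by rewrite -[x i ord0 ^+ 2]real_normK ?num_real// lerXn2r ?nnegrE ?le_coord_normr.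
Qed.

Lemma enorm_ball_nbhs n (x : 'cV[R]_n) e : 0 < e ->
  nbhs x [set y | enorm (y - x) < e].
Proof.
move=> e0; have c0 : 0 < Num.sqrt n%:R + 1 :> R by rewrite ltr_wpDl ?sqrtr_ge0.
apply/nbhs_ballP; exists (e / (Num.sqrt n%:R + 1)); first exact: divr_gt0.
move=> y; rewrite mx_norm_ball /ball_/= ltr_pdivlMr// => xy.
rewrite enormB (le_lt_trans (enorm_le_normr _))// (le_lt_trans _ xy)//.
by rewrite mulrC ler_wpM2l// lerDl.
Qed.

Lemma continuous_enormP m n (f : 'cV[R]_n -> 'cV[R]_m) x : continuous_at x f <->
  forall e, 0 < e -> exists2 d, 0 < d &
    forall y, enorm (y - x) < d -> enorm (f y - f x) < e.
Proof.
split=> [fx e e0|fx].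
  have /nbhs_ballP[d/= d0 fd] := fx _ (enorm_ball_nbhs (f x) e0).
  exists d => // y xy; apply: fd; rewrite mx_norm_ball /ball_/=.
  by rewrite (le_lt_trans (le_normr_enorm _))// enormB.
move=> A /nbhs_ballP[e /= /fx[d d0 fd] eA].
apply: filterS (enorm_ball_nbhs x d0) => y xy; apply: eA.
by rewrite mx_norm_ball /ball_/= (le_lt_trans (le_normr_enorm _))// enormB fd.
Qed.

Lemma mulmx_enorm_bounded m n (g : 'M[R]_(m, n)) :
  exists2 C, 0 < C & forall x : 'cV_n, enorm (g *m x) <= C * enorm x.
Proof.
pose K := \sum_i \sum_j `|g i j|.
have K0 : 0 <= K by rewrite sumr_ge0// => i _; rewrite sumr_ge0.
exists (Num.sqrt m%:R * K + 1) => [|x].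
  by rewrite ltr_wpDl ?mulr_ge0 ?sqrtr_ge0.
rewrite (le_trans (enorm_le_normr _))//.
rewrite mulrDl mul1r ler_wpDr ?enorm_ge0// -mulrA ler_wpM2l ?sqrtr_ge0//.
rewrite [leLHS]/Num.norm/= mx_normrE; apply/bigmax_leP; split=> [|[i j] _].
  by rewrite mulr_ge0 ?enorm_ge0.
rewrite mxE (le_trans (ler_norm_sum _ _ _))//= /K (bigD1 i)//= mulrDl.
rewrite ler_wpDr ?mulr_ge0 ?enorm_ge0//.
  by rewrite sumr_ge0// => k _; rewrite sumr_ge0.
rewrite mulr_suml ler_sum// => k _.
by rewrite normrM ler_wpM2l// (ord1 j) le_coord_enorm.
Qed.

Lemma trmx_continuous m n : continuous (@trmx R m n).
Proof.
move=> A U /nbhs_ballP[e /= e0 eU].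
apply: filterS (nbhsx_ballx A e e0) => B [_ AB]; apply: eU.
by split=> // i j; rewrite !mxE; exact: AB.
Qed.

Lemma enorm_ball_compact n (r : R) :
  exists2 K : set 'cV[R]_n, compact K & forall x, enorm x <= r -> K x.
Proof.
exists (trmx @` [set v : 'rV[R]_n | forall i, `[- r, r]%classic (v ord0 i)]).
  apply: continuous_compact.
    by apply: continuous_subspaceT; exact: trmx_continuous.
  by apply: (@rV_compact R _ (fun=> `[- r, r]%classic)) => _; exact: segment_compact.
move=> x xr; exists x^T; rewrite ?trmxK// => i /=.
by rewrite mxE in_itv/= -ler_norml (le_trans (le_coord_enorm _ _)).
Qed.

Lemma continuous_bounded_on_ball m n (f : 'cV[R]_n -> 'cV[R]_m) (r : R) :
  continuous f -> exists M, forall x, enorm x <= r -> enorm (f x) <= M.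
Proof.
move=> cf; have [K cK Kr] := enorm_ball_compact n r.
have /compact_bounded[M [_ /(_ (M + 1))]] : compact (f @` K).
  by apply: continuous_compact => //; exact: continuous_subspaceT.
rewrite ltrDl => /(_ ltr01) fM; exists (Num.sqrt m%:R * (M + 1)) => x xr.
rewrite (le_trans (enorm_le_normr _))// ler_wpM2l ?sqrtr_ge0// fM//.
by exists x => //; exact: Kr.
Qed.

End EuclideanNorm.

(** * The distance [hull_dist] as local proximity *)

Section LocalCloseness.
Context {R : realType} {n : nat}.
Notation V := ('cV[R]_n).
Implicit Types (A B P Q : set V) (r rho eta : R).

Lemma patchE r P x : patch r P x <-> P x /\ enorm x < r.
Proof. by rewrite /patch /eball /= subr0; split=> -[]. Qed.

Lemma translateE P x y : translate P x y <-> P (y + x).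
Proof.
split=> [[p Pp <-]|Pyx]; first by rewrite subrK.
by exists (y + x) => //; rewrite addrK.
Qed.

Definition approx rho eta A B :=
  forall a, A a -> enorm a < rho -> exists2 b, B b & enorm (a - b) < eta.

(** These relations are a base of the uniformity that [hull_dist] induces on the
    nonempty sets; unlike [hull_dist] they do not involve spheres, and the
    estimates are made in terms of them. *)
Definition locally_close rho eta A B := approx rho eta A B /\ approx rho eta B A.

Lemma hausdorff_dist_le A B e :
  (forall a, A a -> exists2 b, B b & enorm (a - b) <= e) ->
  (forall b, B b -> exists2 a, A a & enorm (b - a) <= e) ->
  (hausdorff_dist A B <= e%:E)%E.
Proof.
move=> AB BA; rewrite /hausdorff_dist ge_max; apply/andP.
split; apply: ge_ereal_sup => _ [x xS <-]; apply: ge_ereal_inf.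
  by have [y yB xy] := AB _ xS; exists (enorm (x - y))%:E; [exists y|].
have [y yA xy] := BA _ xS; exists (enorm (y - x))%:E; first by exists y.
by rewrite lee_fin enormB.
Qed.

Lemma hausdorff_dist_near A B e e' : e < e' -> (hausdorff_dist A B <= e%:E)%E ->
  (forall a, A a -> exists2 b, B b & enorm (a - b) < e') /\
  (forall b, B b -> exists2 a, A a & enorm (b - a) < e').
Proof.
move=> ee'; rewrite /hausdorff_dist ge_max => /andP[/ereal_supP AB /ereal_supP BA].
split=> [a Aa|b Bb].
  have : (ereal_inf [set (enorm (a - b))%:E | b in B] < e'%:E)%E.
    by rewrite (le_lt_trans (AB _ _)) ?lte_fin//; exists a.
  by move=> /ereal_inf_lt[_ [b Bb <-]]; rewrite lte_fin; exists b.
have : (ereal_inf [set (enorm (a - b))%:E | a in A] < e'%:E)%E.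
  by rewrite (le_lt_trans (BA _ _)) ?lte_fin//; exists b.
by move=> /ereal_inf_lt[_ [a Aa <-]]; rewrite lte_fin enormB; exists a.
Qed.

(** A point of [B] near [a] may lie outside of the ball; the sphere then takes
    its place, the radial projection of [a] being at least as near. *)
Lemma approx_patch_sphere r eta A B : 0 < eta -> eta <= r -> approx r eta A B ->
  forall a, (patch r A `|` esphere r) a ->
    exists2 b, (patch r B `|` esphere r) b & enorm (a - b) <= eta.
Proof.
move=> eta0 etar AB a [/patchE[Aa ar]|ar]; last first.
  by exists a; [right|rewrite subrr enorm0 ltW].
have [b Bb ab] := AB a Aa ar.
have [br|rb] := ltP (enorm b) r.
  by exists b; [left; apply/patchE|exact: ltW].
have a0 : 0 < enorm a.
  rewrite lt0r enorm_ge0 andbT; apply/eqP => /enorm_eq0 a0.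
  by move: ab; rewrite a0 sub0r enormN; lra.
exists ((r / enorm a) *: a).
  right; rewrite /esphere/= enormZ ger0_norm ?divfK ?gt_eqF// divr_ge0 ?ltW//; lra.
rewrite -{1}[a]scale1r -scalerBl enormZ -[enorm a in X in _ * X]ger0_norm ?ltW//.
rewrite -normrM mulrBl mul1r divfK ?gt_eqF// ler0_norm; last lra.
have := enorm_leD b a; rewrite enormB; lra.
Qed.

Let dist_bounds A B := [set e : R | 0 < e /\
  (hausdorff_dist (patch e^-1 A `|` esphere e^-1)
                  (patch e^-1 B `|` esphere e^-1) <= e%:E)%E].

Lemma hull_dist_le_of_close e A B : 0 < e ->
  locally_close e^-1 (Num.min e e^-1) A B -> hull_dist A B <= e.
Proof.
move=> e0 [AB BA].
have m0 : 0 < Num.min e e^-1 by rewrite lt_min e0 invr_gt0.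
apply: (@ge_inf _ (dist_bounds A B)); first by exists 0 => d [/ltW].
have me : Num.min e e^-1 <= e^-1 by rewrite ge_min lexx orbT.
split=> //; apply: hausdorff_dist_le => x.
  move=> /(approx_patch_sphere m0 me AB)[y Ay xy].
  by exists y => //; rewrite (le_trans xy)// ge_min lexx.
move=> /(approx_patch_sphere m0 me BA)[y Ay xy].
by exists y => //; rewrite (le_trans xy)// ge_min lexx.
Qed.

(** The infimum defining [hull_dist] is over a nonempty set, since [1] is always
    a bound: a point of the unit ball is within [1] of the unit sphere.  In
    dimension [0] the sphere is empty, and the point [0] of [B] serves instead. *)
Lemma hull_dist_bound1 A B : A !=set0 -> B !=set0 -> dist_bounds A B 1.
Proof.
have near_sphere (C D : set V) : D !=set0 ->
    forall a, (patch (1^-1) C `|` esphere (1^-1)) a ->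
    exists2 b, (patch (1^-1) D `|` esphere (1^-1)) b & enorm (a - b) <= 1.
  rewrite invr1 => -[d Dd] a [/patchE[Ca a1]|a1]; last first.
    by exists a; [right|rewrite subrr enorm0].
  have unit (x : V) : x != 0 -> enorm ((enorm x)^-1 *: x) = 1.
    move=> x0; have xn0 : enorm x != 0 by apply: contra_neq x0; exact: enorm_eq0.
    by rewrite enormZ ger0_norm ?invr_ge0 ?enorm_ge0// mulVf.
  have [->|a0] := eqVneq a 0.
    have [d0|d0] := eqVneq d 0.
      by exists 0; [left; apply/patchE; rewrite -{1}d0 enorm0|rewrite subrr enorm0].
    exists ((enorm d)^-1 *: d); first by right; exact: unit.
    by rewrite sub0r enormN unit.
  exists ((enorm a)^-1 *: a); first by right; exact: unit.
  have an0 : enorm a != 0 by apply: contra_neq a0; exact: enorm_eq0.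
  rewrite -{1}[a]scale1r -scalerBl enormZ.
  rewrite -[enorm a in X in _ * X]ger0_norm ?enorm_ge0//.
  rewrite -normrM mulrBl mul1r mulVf// ler0_norm; have := enorm_ge0 a; lra.
by move=> A0 B0; split=> //; apply: hausdorff_dist_le; exact: near_sphere.
Qed.

Lemma close_of_hull_dist rho eta : 0 < eta -> exists2 delta, 0 < delta &
  forall A B, A !=set0 -> B !=set0 -> hull_dist A B < delta ->
    locally_close rho eta A B.
Proof.
move=> eta0; pose r := `|rho| + 1.
have r0 : 0 < r by rewrite ltr_wpDl.
exists (Num.min (2^-1) (Num.min (eta / 2) r^-1)).
  by rewrite !lt_min !invr_gt0 r0 divr_gt0// ltr0n.
move=> A B A0 B0 /inf_lt[|e [e0 dAB]]; first by exists 1; exact: hull_dist_bound1.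
rewrite !lt_min => /and3P[e2 eeta er].
have {}er : r < e^-1 by rewrite -[r]invrK ltf_pV2 ?posrE ?invr_gt0.
have ee : e < e + e by lra.
have {dAB}[AB BA] := hausdorff_dist_near ee dAB.
have rrho : rho <= r - 1 by rewrite addrK ler_norm.
(* a point of the sphere is too far from [a] to be the one within [2 e] *)
have key (C D : set V) : (forall a, (patch e^-1 C `|` esphere e^-1) a ->
      exists2 b, (patch e^-1 D `|` esphere e^-1) b & enorm (a - b) < e + e) ->
    approx rho eta C D.
  move=> CD a Ca arho.
  have [|b [/patchE[Db _] ab|be ab]] := CD a.
  - by left; apply/patchE; split=> //; lra.
  - by exists b => //; lra.
  - by have := enorm_leD b a; rewrite enormB be; lra.
by split; exact: key.
Qed.

Lemma approx_translate rho eta A B x :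
  approx (rho + enorm x) eta A B -> approx rho eta (translate A x) (translate B x).
Proof.
move=> AB _ [a Aa <-] axr.
have [|b Bb ab] := AB a Aa.
  by rewrite -[a](subrK x) (le_lt_trans (enormD _ _))// ltrD2r.
by exists (b - x); [exists b|rewrite opprB addrA subrK].
Qed.

(** Closeness up to a radius larger by [enorm x] survives the change of origin. *)
Lemma hull_dist_translate x e : 0 < e -> exists2 delta, 0 < delta &
  forall A B, A !=set0 -> B !=set0 -> hull_dist A B < delta ->
    hull_dist (translate A x) (translate B x) <= e.
Proof.
move=> e0; have m0 : 0 < Num.min e e^-1 by rewrite lt_min e0 invr_gt0.
have [delta d0 close] := close_of_hull_dist (e^-1 + enorm x) m0.
exists delta => // A B A0 B0 /(close _ _ A0 B0)[AB BA].
by apply: hull_dist_le_of_close => //; split; exact: approx_translate.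
Qed.

End LocalCloseness.

(** * Extension of uniformly continuous maps to completions *)

Section CompletionExtension.
Context {R : realType} {X Y : Type} {dX : X -> X -> R} {dY : Y -> Y -> R}.
Variables (O : completion dX) (O' : completion dY).

(** The filter along which [hull_act] is a limit: the trace on [X] of the
    neighbourhoods of [w]. *)
Definition trace (w : O) : set_system X :=
  filter_from (nbhs w) (fun U => completion_in O @^-1` U).

#[local] Instance trace_proper w : ProperFilter (trace w).
Proof.
apply: filter_from_proper; first apply: filter_from_filter.
- by exists setT; exact: filterT.
- by move=> A B wA wB; exists (A `&` B) => //; exact: filterI.
- move=> A wA.
  have [|v [/interior_subset Av [a _ av]]] :=
      @completion_dense _ _ _ O A^° _ (@open_interior _ A).
    by exists w.
  by exists a; rewrite /= av.
Qed.

Lemma trace_near w e : 0 < e -> trace w [set a | mdist w (completion_in O a) < e].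
Proof.
move=> e0; exists (ball w e); first exact: nbhsx_ballx.
by move=> a /=; rewrite ballEmdist.
Qed.

Lemma completion_in_cvg_trace w : completion_in O @ trace w --> w.
Proof. by move=> U wU; exists U. Qed.

Section UniformlyContinuous.
Variable f : X -> O'.
Hypothesis f_unif : forall e, 0 < e -> exists2 delta, 0 < delta &
  forall a b, dX a b < delta -> mdist (f a) (f b) < e.

Lemma unif_cvg_trace w : exists l : O', f @ trace w --> l.
Proof.
apply: completion_complete; apply: cauchy_exP => e /f_unif[delta d0 fd].
have d20 : 0 < delta / 2 by rewrite divr_gt0.
have [a wa] := filter_ex (trace_near w d20).
exists (f a); apply: filterS (trace_near w d20) => b wb.
rewrite ballEmdist; apply: fd.
rewrite -(completion_isometry O) (le_lt_trans (metric_triangle _ w _))//.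
by rewrite [ltRHS]splitr ltrD// metric_sym.
Qed.

Variable F : O -> O'.
Hypothesis F_lim : forall w, f @ trace w --> F w.

Lemma unif_lim_continuous : continuous F.
Proof.
move=> w; apply/metricType_numDomainType.cvgrPdist_lt => e e0.
have e30 : 0 < e / 3 by rewrite divr_gt0.
have [delta d0 fd] := f_unif e30.
have d30 : 0 < delta / 3 by rewrite divr_gt0.
have near_pt v : exists2 a, mdist v (completion_in O a) < delta / 3 &
    mdist (F v) (f a) < e / 3.
  have /metricType_numDomainType.cvgrPdist_lt/(_ _ e30) Fv := @F_lim v.
  by have [a []] := filter_ex (filterI (trace_near v d30) Fv); exists a.
apply: filterS (nbhsx_ballx w _ d30) => v; rewrite ballEmdist/= => wv.
have [a wa Fa] := near_pt w; have [b vb Fb] := near_pt v.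
have ab : dX a b < delta.
  rewrite -(completion_isometry O).
  have := metric_triangle (completion_in O a) w (completion_in O b).
  have := metric_triangle w v (completion_in O b).
  rewrite (metric_sym _ w); lra.
have := fd _ _ ab; have := metric_triangle (F w) (f a) (F v).
have := metric_triangle (f a) (f b) (F v); rewrite (metric_sym (f b)); lra.
Qed.

Lemma unif_lim_extends a : F (completion_in O a) = f a.
Proof.
apply: (cvg_unique (@metric_hausdorff _ _) (@F_lim _)).
apply/metricType_numDomainType.cvgrPdist_lt => e /f_unif[delta d0 fd].
apply: filterS (trace_near (completion_in O a) d0) => b /=.
by rewrite completion_isometry; exact: fd.
Qed.

End UniformlyContinuous.

Lemma continuous_eq_on_completion (F G : O -> O') : continuous F -> continuous G ->
  (forall a, F (completion_in O a) = G (completion_in O a)) -> F = G.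
Proof.
move=> cF cG FG; apply/funext => w.
have lim_trace (H : O -> O') : continuous H ->
    (H \o completion_in O) @ trace w --> H w.
  move=> cH U /cH HU; exact: (completion_in_cvg_trace HU).
have := lim_trace F cF.
rewrite (_ : F \o _ = G \o completion_in O); last exact/funext.
by move=> /(cvg_unique (@metric_hausdorff _ _)); apply; exact: lim_trace.
Qed.

End CompletionExtension.

(** * The translation action on the hull *)

Section HullAction.
Context {R : realType} {n : nat} {P : set 'cV[R]_n}.
Hypothesis P0 : P !=set0.
Variable O : hull P.

Lemma orb_nonempty (A : orb P) : sval A !=set0.
Proof.
case: A => A /= /set_mem[x _ <-].
by have [p Pp] := P0; exists (p - x), p.
Qed.

Lemma orb_shift_unif x e : 0 < e -> exists2 delta, 0 < delta &
  forall A B : orb P, hull_dist (sval A) (sval B) < delta ->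
    mdist (hull_in O (orb_shift A x)) (hull_in O (orb_shift B x)) < e.
Proof.
move=> e0; have e20 : 0 < e / 2 by rewrite divr_gt0.
have [delta d0 td] := hull_dist_translate x e20.
exists delta => // A B /(td _ _ (orb_nonempty A) (orb_nonempty B)) AB.
by rewrite /hull_in completion_isometry (le_lt_trans AB)//; lra.
Qed.

Lemma hull_act_lim (w : O) x :
  (fun A => hull_in O (orb_shift A x)) @ trace w --> hull_act w x.
Proof.
have [l lP] := unif_cvg_trace (orb_shift_unif x) w.
apply: (@xgetPex _ w [set w' : O |
  (fun A => hull_in O (orb_shift A x)) @ trace w --> w']).
by exists l.
Qed.

Lemma hull_act_continuous x : continuous (fun w : O => hull_act w x).
Proof.
apply: (unif_lim_continuous (@orb_shift_unif x)) => w.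
exact: hull_act_lim.
Qed.

Lemma hull_act_in (A : orb P) x :
  hull_act (hull_in O A) x = hull_in O (orb_shift A x).
Proof.
have act_lim w := @hull_act_lim w x.
exact: (@unif_lim_extends _ _ _ _ _ _ _ _ (@orb_shift_unif x) _ act_lim A).
Qed.

End HullAction.

(** * Separated sets and finite local complexity *)

Section FiniteLocalComplexity.
Context {R : realType} {n : nat}.
Notation V := ('cV[R]_n).
Implicit Types (A B P Q S : set V) (r rho eta : R).

(** Used for a common bound over finitely many patches, for a common gap between
    finitely many points, and for an ultrafilter choosing one patch among
    finitely many. *)
Lemma filter_bigI_finite (I : choiceType) T (F : set_system T) (D : set I)
    (f : I -> set T) : Filter F -> finite_set D ->
  (forall i, D i -> F (f i)) -> F (\bigcap_(i in D) f i).
Proof.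
move=> FF /finite_fsetP[X ->] Ff; apply: filter_bigI => i iX; exact: Ff.
Qed.

Lemma finite_gap0 S : finite_set S -> exists2 delta : R, 0 < delta &
  forall z, S z -> enorm z < delta -> z = 0.
Proof.
move=> finS.
have : \forall d \near 0^'+, forall z, S z -> enorm z < d -> z = 0.
  apply: (@filter_bigI_finite _ _ (0^'+)
    S (fun z => [set d : R | enorm z < d -> z = 0])) => // z _.
  have [->|z0] := eqVneq z 0; first exact: filterE.
  have z_gt0 : 0 < enorm z.
    by rewrite lt0r enorm_ge0 andbT; apply: contra_neq z0; exact: enorm_eq0.
  apply: filterS (nbhs_right_le z_gt0) => d dz zd.
  by have := lt_le_trans zd dz; rewrite ltxx.
move=> gap; have [d [d0 Sd]] := filter_ex (filterI (nbhs_right_gt 0) gap).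
by exists d.
Qed.

Definition separated s P := forall p q, P p -> P q -> enorm (p - q) < s -> p = q.

Lemma uniformly_discreteP P :
  uniformly_discrete P <-> exists2 s, 0 < s & separated s P.
Proof.
rewrite /uniformly_discrete.
set D := (X in ereal_inf X); split=> [inf0|[s s0 sepP]]; last first.
  apply: (@lt_le_trans _ _ s%:E); first by rewrite lte_fin.
  apply: le_ereal_inf_tmp => _ [p [q [Pp Pq pq ->]]].
  rewrite lee_fin leNgt; apply: contra_neqN pq; exact: sepP.
have [s s0 sD] : exists2 s, 0 < s & (s%:E <= ereal_inf D)%E.
  case: (ereal_inf D) inf0 => [s|_|//]; last by exists 1; rewrite ?leey.
  by rewrite lte_fin => s0; exists s.
exists s => // p q Pp Pq; apply: contraPP => /eqP pq; apply/negP; rewrite -leNgt.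
by rewrite -lee_fin (le_trans sD)// ereal_inf_lbound//; exists p, q.
Qed.

(** A compact set is covered by finitely many sets that each contain at most one
    point of [P]. *)
Lemma separated_finite_patch s P r : 0 < s -> separated s P ->
  finite_set (patch r P).
Proof.
move=> s0 sepP; have [K cK Kr] := enorm_ball_compact n r.
pose U (c : V) : set V := [set y : V | enorm (y - c) < s / 2]^°.
have UE c y : U c y -> enorm (y - c) < s / 2 by move/interior_subset.
move: cK; rewrite compact_cover => /(_ V K U)[c _||D _ KD].
- exact: open_interior.
- by move=> c Kc; exists c => //; apply: enorm_ball_nbhs; rewrite divr_gt0.
apply: (@sub_finite_set V _ (\bigcup_(c in [set` D]) (U c `&` patch r P))).
  move=> p /[dup] Pp /patchE[_ /ltW/Kr/KD[c Dc Uc]]; by exists c.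
apply: bigcup_finite => // c _.
have [[p [/UE cp /patchE[Pp _]]]|none] := pselect ((U c `&` patch r P) !=set0).
  apply: (@sub_finite_set _ _ [set p]) => // q [/UE cq /patchE[Pq _]].
  apply: sepP => //; have := enorm_triangle c q p; rewrite (enormB c p); lra.
by apply: (@sub_finite_set _ _ set0) => // q qc; case: none; exists q.
Qed.

Lemma separated_translate s P x : separated s P -> separated s (translate P x).
Proof.
move=> sepP _ _ [p Pp <-] [q Pq <-].
by rewrite opprB addrA subrK => /sepP->.
Qed.

Lemma patch_translate_gap P r : uniformly_discrete P ->
    finite_local_complexity P -> exists2 delta, 0 < delta &
  forall a b u v, P a -> P b -> patch r (translate P a) u ->
    patch r (translate P b) v -> enorm (u - v) < delta -> u = v.
Proof.
move=> /uniformly_discreteP[s s0 sepP] /(_ r) finP.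
pose U := \bigcup_(A in [set patch r (translate P x) | x in P]) A.
have finU : finite_set U.
  apply: bigcup_finite => // _ [a Pa <-].
  exact: separated_finite_patch s0 (separated_translate sepP).
have [d d0 gap] := finite_gap0 (finite_image2 (fun u v => u - v) finU finU).
exists d => // a b u v Pa Pb ua vb /gap uv; apply/eqP; rewrite -subr_eq0.
apply/eqP/uv; exists u; first by exists (patch r (translate P a)) => //; exists a.
by exists v => //; exists (patch r (translate P b)) => //; exists b.
Qed.

Lemma relatively_denseP P : relatively_dense P ->
  exists2 r, 0 < r & forall x, exists2 p, P p & enorm (p - x) < r.
Proof.
move=> [r dP]; exists (`|r| + 1); first by rewrite ltr_wpDl.
move=> x; have [_ /patchE[[p Pp <-] pr]] := dP x.
by exists p => //; have := ler_norm r; lra.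
Qed.

Lemma patch_eq_translate r r' A B x : r' + enorm x <= r ->
  patch r A = patch r B -> patch r' (translate A x) = patch r' (translate B x).
Proof.
move=> xr AB; have sub A' B' : patch r A' = patch r B' ->
    patch r' (translate A' x) `<=` patch r' (translate B' x).
  move=> AB' y /patchE[/translateE Ayx yr]; apply/patchE; split=> //.
  apply/translateE; suff /patchE[] : patch r B' (y + x) by [].
  by rewrite -AB'; apply/patchE; split=> //; have := enormD y x; lra.
by apply/seteqP; split; apply: sub.
Qed.

Lemma patch_eq_le r r' A B : r' <= r -> patch r A = patch r B ->
  patch r' A = patch r' B.
Proof.
move=> rr' AB; rewrite -(translate0 A) -(translate0 B).
by apply: patch_eq_translate AB; rewrite enorm0 addr0.
Qed.

(** If [P - x] and [P - y] are [hull_dist]-close, choose points [p0] of [P - x]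
    and [q0] of [P - y] that are near the origin and near each other.  The patches
    of [P] around [x + p0] and [y + q0] are then close, so they are equal by
    [patch_translate_gap], and [P - x] agrees with [P - y] moved by [q0 - p0]. *)
Lemma hull_dist_patch_eq P rho eta : Delone P -> finite_local_complexity P ->
  0 < eta -> exists2 delta, 0 < delta & forall x y,
    hull_dist (translate P x) (translate P y) < delta ->
    exists2 s, enorm s < eta &
      patch rho (translate P x) = patch rho (translate P (y + s)).
Proof.
move=> [udP rdP] flcP eta0; have [r0 r0_gt0 dense] := relatively_denseP rdP.
pose r1 := `|rho| + r0.
have [d1 d1_gt0 gap] := patch_translate_gap (r1 + 1) udP flcP.
pose t := Num.min eta (Num.min (d1 / 2) (2^-1)).
have t0 : 0 < t by rewrite !lt_min eta0 invr_gt0 divr_gt0/=.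
have teta : t <= eta by rewrite ge_min lexx.
have td : t <= d1 / 2 by rewrite !ge_min lexx orbT.
have t1 : t <= 2^-1 by rewrite !ge_min lexx !orbT.
have ne x : translate P x !=set0.
  by have [p Pp _] := dense x; exists (p - x), p.
have [delta delta0 close] := @close_of_hull_dist R n (r1 + r0 + 1) t t0.
exists delta => // x y /(close _ _ (ne x) (ne y))[xy yx].
have [p Pp px] := dense x; pose p0 := p - x.
have Pp0 : translate P x p0 by exists p.
have rho_r1 : rho + r0 <= r1 by rewrite lerD2r ler_norm.
have r1_gt0 : 0 < r1 by rewrite ltr_wpDl.
have [||q0 Pq0 pq0] := xy p0 => //; first by rewrite -/p0 in px; lra.
have Pq : P (y + q0) by rewrite addrC; apply/translateE.
have Pxp : P (x + p0) by rewrite addrC subrK.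
(* by symmetry it is enough to show one inclusion between the two patches; the
   points that are compared have norm up to [r1 + 1], hence this radius in [gap] *)
have sub x' y' (u v : V) : P (x' + u) -> P (y' + v) -> enorm u < r0 + 1 ->
    enorm (u - v) < t ->
    approx (r1 + r0 + 1) t (translate P x') (translate P y') ->
    patch r1 (translate P (x' + u)) `<=` patch r1 (translate P (y' + v)).
  move=> Pu Pv ur uv x'y' w Pw; have [Pxw wr] := (patchE r1 _ w).1 Pw.
  have [||z Pz wz] := x'y' (w + u).
  - apply/translateE; move/translateE: Pxw; by rewrite (addrC x') addrA.
  - by have := enormD w u; lra.
  have wzv : enorm (w - (z - v)) < t + t.
    rewrite (_ : w - (z - v) = (w + u - z) + (v - u)).
      by rewrite (le_lt_trans (enormD _ _))// ltrD// enormB.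
    by rewrite opprB; apply/colP => i; rewrite !mxE; ring.
  have Pzv : translate P (y' + v) (z - v).
    by apply/translateE; rewrite (addrC y') addrA subrK; apply/translateE.
  have wE : w = z - v.
    apply: (gap _ _ _ _ Pu Pv); last lra.
      by apply/patchE; split=> //; lra.
    apply/patchE; split=> //; have := enorm_leD (z - v) w; rewrite (enormB _ w); lra.
  by apply/patchE; split=> //; rewrite wE.
have p0_lt : enorm p0 < r0 by [].
have q0_lt : enorm q0 < r0 + 1.
  by have := enorm_leD q0 p0; rewrite (enormB q0); lra.
have patch_pq : patch r1 (translate P (x + p0)) = patch r1 (translate P (y + q0)).
  apply/seteqP; split; apply: sub => //; first lra.
  by rewrite enormB.
exists (q0 - p0); first by rewrite enormB; lra.
have -> : y + (q0 - p0) = y + q0 + - p0 by rewrite addrA.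
have {1}-> : x = x + p0 + - p0 by rewrite addrK.
rewrite -!(translateD P (_ + _)); apply: patch_eq_translate patch_pq.
rewrite enormN; lra.
Qed.

End FiniteLocalComplexity.

(** * Equivariant functions *)

Section Equivariance.
Context {R : realType} {n m : nat}.
Notation V := ('cV[R]_n).
Implicit Types (P : set V) (h : V -> 'cV[R]_m).

(** Every [x] is [p + v] with [p] in [P] and [v] in a fixed ball, and the value
    at [p + v] depends only on [v] and on the patch around [p], for which there
    are finitely many possibilities. *)
Lemma strongly_equivariant_bounded P h : relatively_dense P ->
  finite_local_complexity P -> continuous h -> strongly_equivariant P h ->
  exists M, forall x, enorm (h x) <= M.
Proof.
move=> /relatively_denseP[r0 r0_gt0 dense] flcP ch [r hr].
pose patches := [set patch (r + r0) (translate P p) | p in P].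
pose bounds A := [set M | forall p, P p -> patch (r + r0) (translate P p) = A ->
  forall v, enorm v < r0 -> enorm (h (p + v)) <= M].
have : \forall M \near +oo, forall A, patches A -> bounds A M.
  apply: (@filter_bigI_finite _ _ (pinfty_nbhs R) patches bounds).
    exact: flcP.
  move=> _ [p Pp <-].
  have chp : continuous (fun v => h (p + v)).
    move=> v; apply/continuous_enormP => e e0.
    have /continuous_enormP/(_ _ e0)[d d0 hd] := ch (p + v).
    by exists d => // y yv; apply: hd; rewrite opprD addrACA subrr add0r.
  have [M hM] := continuous_bounded_on_ball r0 chp.
  apply: filterS (nbhs_pinfty_ge (num_real M)) => N MN q Pq qp v vr0.
  apply: le_trans MN; rewrite (hr (q + v) (p + v)) ?hM 1?ltW//.
  rewrite -!translateD; apply: patch_eq_translate qp; rewrite lerD2l ltW//.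
move=> /filter_ex[M hM]; exists M => x.
have [p Pp px] := dense x; rewrite -[x](subrKC p).
apply: (hM (patch (r + r0) (translate P p))) => //; first by exists p.
by rewrite enormB.
Qed.

Lemma weakly_equivariant_approx P h e : weakly_equivariant P h -> 0 < e ->
  exists f, [/\ continuous f, strongly_equivariant P f &
                forall x, enorm (h x - f x) < e].
Proof.
move=> [_ wh] /wh[f [cf sf supf]]; exists f; split=> // x.
rewrite -lte_fin (le_lt_trans _ supf)//; apply: le_ereal_sup_tmp.
by exists (enorm (h x - f x))%:E => //; exists x.
Qed.

Lemma weakly_equivariant_bounded P h : relatively_dense P ->
  finite_local_complexity P -> weakly_equivariant P h ->
  exists M, forall x, enorm (h x) <= M.
Proof.
move=> dP flcP wh.
have [f [cf sf hf]] := weakly_equivariant_approx wh ltr01.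
have [M fM] := strongly_equivariant_bounded dP flcP cf sf.
by exists (M + 1) => x; have := enorm_leD (h x) (f x); have := fM x; have := hf x; lra.
Qed.

Lemma weakly_equivariant_patch P h e : weakly_equivariant P h -> 0 < e ->
  exists r, forall x y, patch r (translate P x) = patch r (translate P y) ->
    enorm (h x - h y) < e.
Proof.
move=> wh e0; have e20 : 0 < e / 2 by rewrite divr_gt0.
have [f [_ [r fr] hf]] := weakly_equivariant_approx wh e20.
exists r => x y /fr fxy; have := enorm_triangle (f x) (h x) (h y).
by have := hf x; have := hf y; rewrite fxy (enormB (f y) (h y)); lra.
Qed.

End Equivariance.

(** * Translates of the image *)

Section Image.
Context {R : realType} {n : nat}.
Notation V := ('cV[R]_n).
Variables (P : set V) (phi : V -> V) (g : 'M[R]_n).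
Hypotheses (delP : Delone P) (flcP : finite_local_complexity P).
Hypothesis g_unit : g \in unitmx.
Let h x := phi x - g *m x.
Hypothesis wh : weakly_equivariant P h.
Notation Q := (phi @` P).

Let phiE x : phi x = g *m x + h x.
Proof. by rewrite subrKC. Qed.

Lemma enorm_le_mulmx : exists2 C, 0 < C & forall x : V, enorm x <= C * enorm (g *m x).
Proof.
have [C C0 gC] := mulmx_enorm_bounded (invmx g).
by exists C => // x; rewrite -{1}(mulKmx g_unit x).
Qed.

(** The point of [phi(P) - g y] near the point [phi p - g x] of [phi(P) - g x] is
    the image of the point of [P] that sits at [y + s] as [p] does at [x]. *)
Lemma image_approx rho eta : 0 < eta -> exists rho', exists2 sigma, 0 < sigma &
  forall x y s, enorm s < sigma ->
    patch rho' (translate P x) = patch rho' (translate P (y + s)) ->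
    approx rho eta (translate Q (g *m x)) (translate Q (g *m y)).
Proof.
move=> eta0; have eta20 : 0 < eta / 2 by rewrite divr_gt0.
have [M hM] := weakly_equivariant_bounded delP.2 flcP wh.
have [r hr] := weakly_equivariant_patch wh eta20.
have [C C0 gC] := enorm_le_mulmx; have [C' C'0 gC'] := mulmx_enorm_bounded g.
pose T := C * (rho + M).
exists (`|r| + T), (eta / 2 / C') => [|x y s ssig]; first exact: divr_gt0.
have {ssig}gs : enorm (g *m s) < eta / 2.
  by rewrite (le_lt_trans (gC' s))// mulrC -ltr_pdivlMr.
move=> pxy _ [_ [p Pp <-] <-].
rewrite phiE addrAC -mulmxBr => arho.
have pxT : enorm (p - x) < T.
  rewrite (le_lt_trans (gC _))// ltr_pM2l//.
  have := enormD (g *m (p - x) + h p) (- h p); rewrite addrK enormN.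
  by have := hM p; lra.
pose p' := p - x + (y + s).
have Pp' : P p'.
  suff /patchE[/translateE] : patch (`|r| + T) (translate P (y + s)) (p - x) by [].
  rewrite -pxy; apply/patchE; split; first by exists p.
  by rewrite (lt_le_trans pxT)// lerDr.
have hpp' : enorm (h p - h p') < eta / 2.
  have rT : r + enorm (p - x) <= `|r| + T by rewrite lerD ?ler_norm// ltW.
  apply: hr; have := patch_eq_translate rT pxy.
  by rewrite !translateD subrKC [y + s + _]addrC.
exists (phi p' - g *m y); first by exists (phi p') => //; exists p'.
rewrite phiE /p' !mulmxDr -/p'.
rewrite (_ : _ - _ = (h p - h p') - g *m s).
  by have := enormD (h p - h p') (- (g *m s)); rewrite enormN; lra.
by apply/colP => i; rewrite !mxE; ring.
Qed.

Lemma image_hull_dist e : 0 < e -> exists2 delta, 0 < delta & forall x y,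
  hull_dist (translate P x) (translate P y) < delta ->
  hull_dist (translate Q (g *m x)) (translate Q (g *m y)) <= e.
Proof.
move=> e0; have m0 : 0 < Num.min e e^-1 by rewrite lt_min e0 invr_gt0.
have [rho [sigma sig0 close]] := image_approx e^-1 m0.
have s0 : 0 < Num.min sigma 1 by rewrite lt_min sig0/=.
have [delta d0 near_patch] := hull_dist_patch_eq (rho + 1) delP flcP s0.
exists delta => // x y /near_patch[s]; rewrite lt_min => /andP[ssig s1] pxy.
(* the converse approximation comes from the same patches, moved back by [s] *)
apply: hull_dist_le_of_close => //; split.
  by apply: (close x y s) => //; apply: patch_eq_le pxy; rewrite lerDl.
apply: (close y x (- s)); first by rewrite enormN.
have rho1 : rho + enorm (- s) <= rho + 1 by rewrite enormN lerD2l ltW.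
by have := patch_eq_translate rho1 pxy; rewrite !translateD addrK.
Qed.

End Image.

(** * Compactness of the orbit *)

Section OrbitCompactness.
Context {R : realType} {n : nat}.
Notation V := ('cV[R]_n).
Variable P : set V.
Hypotheses (dP : relatively_dense P) (flcP : finite_local_complexity P).

Lemma ultra_bounded_cvg (F : set_system V) (f : V -> V) r : UltraFilter F ->
  (forall x, enorm (f x) <= r) ->
  exists l, forall e, 0 < e -> F [set x | enorm (f x - l) < e].
Proof.
move=> UF fr; have [K cK Kr] := enorm_ball_compact n r.
have FK : F [set x | K (f x)] by apply: filterE => x; apply: Kr; exact: fr.
have [l [_ fl]] := cK (f @ F) (fmap_proper_filter f (@ultra_proper _ _ UF)) FK.
exists l => e e0.
have [//|far] := in_ultra_setVsetC [set x | enorm (f x - l) < e] UF.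
have {}far : (f @ F) (~` [set y | enorm (y - l) < e]) by [].
by have [y [/= yfar /yfar]] := fl _ _ far (enorm_ball_nbhs l e0).
Qed.

(** Write [x] as [c x - (c x - x)] with [c x] in [P] near [x]: along an ultrafilter
    the bounded vector [c x - x] converges, and the patch around [c x], one of
    finitely many, is eventually constant.  Hence [P - x] is eventually within any
    given distance of one of its terms. *)
Lemma orbit_ultra_cvg (O : hull P) (F : set_system V) : UltraFilter F ->
  exists w : O, (fun x => hull_in O (orb_pt P x)) @ F --> w.
Proof.
move=> UF; apply: completion_complete; apply: cauchy_exP => e e0.
have e20 : 0 < e / 2 by rewrite divr_gt0.
have [r0 r0_gt0 dense] := relatively_denseP dP.
have /choice[c cP] : forall x, exists p, P p /\ enorm (p - x) < r0.
  by move=> x; have [p Pp px] := dense x; exists p.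
have [l vl] := @ultra_bounded_cvg F (fun x => c x - x) r0 UF
  (fun x => ltW (cP x).2).
pose rho := (e / 2)^-1.
pose eta := Num.min (e / 2) rho.
have eta20 : 0 < eta / 2 by rewrite divr_gt0// lt_min e20 invr_gt0.
pose class x := patch (rho + r0) (translate P (c x)).
(* otherwise the ultrafilter avoids each of the finitely many patches *)
have [x0 Fx0] : exists x0, F [set x | class x = class x0].
  apply: contrapT => none.
  have : F (\bigcap_(A in [set patch (rho + r0) (translate P x) | x in P])
      [set x | class x <> A]).
    apply: filter_bigI_finite; first exact: flcP.
    move=> _ [a Pa <-].
    have [Fa|//] := in_ultra_setVsetC [set x | class x =
      patch (rho + r0) (translate P a)] UF.
    have [x1 /= x1a] := filter_ex Fa.
    by case: none; exists x1; rewrite x1a.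
  move=> /filter_ex[x xnone]; apply: (xnone (class x)) => //.
  by exists (c x) => //; exact: (cP x).1.
have Fgood : F [set x | class x = class x0 /\ enorm ((c x - x) - l) < eta / 2].
  exact: filterI Fx0 (vl _ eta20).
have [z [/= z0 zl]] := filter_ex Fgood.
exists (hull_in O (orb_pt P z)); apply: filterS Fgood => x [/= x_0 xl].
rewrite ballEmdist/= /hull_in completion_isometry/=.
apply: (@le_lt_trans _ _ (e / 2)); last lra.
have v_close : enorm ((c z - z) - (c x - x)) < eta.
  have := enorm_triangle l (c z - z) (c x - x).
  by rewrite (enormB l); lra.
have key x1 x2 : class x1 = class x2 ->
    enorm ((c x1 - x1) - (c x2 - x2)) < eta ->
    approx rho eta (translate P x1) (translate P x2).
  move=> c12 v12 a Pa ar.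
  have cx x' : translate P x' = translate (translate P (c x')) (- (c x' - x')).
    by rewrite translateD subKr.
  have : patch (rho + r0) (translate P (c x1)) (a - (c x1 - x1)).
    apply/patchE; split; first by move: Pa; rewrite cx => /translateE.
    have := enormD a (- (c x1 - x1)); rewrite enormN.
    by have [_] := cP x1; lra.
  rewrite -/(class x1) c12 => /patchE[Pb _].
  exists (a - (c x1 - x1) + (c x2 - x2)).
    by rewrite cx; apply/translateE; rewrite addrK.
  by rewrite -addrA opprD addNKr opprD opprK.
apply: hull_dist_le_of_close => //; split; apply: key; rewrite ?z0 ?x_0//.
by rewrite enormB.
Qed.

End OrbitCompactness.

(** * The image of a strongly equivariant deformation *)

Section DeloneImage.
Context {R : realType} {n : nat}.
Notation V := ('cV[R]_n).
Variables (P : set V) (phi : V -> V) (g : 'M[R]_n).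
Hypotheses (delP : Delone P) (flcP : finite_local_complexity P).
Hypothesis g_unit : g \in unitmx.
Let h x := phi x - g *m x.

Let phiE x : phi x = g *m x + h x.
Proof. by rewrite subrKC. Qed.

Lemma strongly_equivariant_finite_range (f : V -> V) :
  strongly_equivariant P f -> finite_set (f @` P).
Proof.
move=> [r fr]; pose patch_at p := patch r (translate P p).
pose rep A := xget 0 [set p | P p /\ patch_at p = A].
apply: (@sub_finite_set _ _ ((fun A => f (rep A)) @` (patch_at @` P))).
  move=> _ [p Pp <-]; exists (patch_at p); first by exists p.
  have [_ rep_p] : P (rep (patch_at p)) /\ patch_at (rep (patch_at p)) = patch_at p.
    by apply: (@xgetPex _ 0 [set q | P q /\ patch_at q = patch_at p]); exists p.
  exact: fr.
by apply: finite_image; exact: flcP.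
Qed.

(** A difference [phi p - phi q] of norm less than [1] is
    [g (p - q) + h p - h q] with [p - q] bounded, so it takes finitely many
    values; the nonzero ones are bounded away from [0]. *)
Lemma image_uniformly_discrete M : (forall x, enorm (h x) <= M) ->
  strongly_equivariant P h -> uniformly_discrete (phi @` P).
Proof.
move=> hM /strongly_equivariant_finite_range finH.
have [C C0 gC] := enorm_le_mulmx g_unit.
pose T := C * (1 + 2 * M).
pose W := \bigcup_(A in [set patch T (translate P x) | x in P]) A.
have finW : finite_set W.
  apply: bigcup_finite; first exact: flcP.
  move=> _ [x Px <-]; have /uniformly_discreteP[s s0 sepP] := delP.1.
  exact: separated_finite_patch s0 (separated_translate sepP).
have finD := finite_image2 (fun u v => u + v)
  (finite_image (fun u => g *m u) finW) (finite_image2 (fun u v => u - v) finH finH).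
have [delta d0 gap] := finite_gap0 finD.
apply/uniformly_discreteP; exists (Num.min 1 delta); first by rewrite lt_min ltr01.
move=> _ _ [p Pp <-] [q Pq <-]; rewrite lt_min => /andP[pq1 pqd].
have pqE : phi p - phi q = g *m (p - q) + (h p - h q).
  by rewrite mulmxBr !phiE; apply/colP => i; rewrite !mxE; ring.
apply/eqP; rewrite -subr_eq0; apply/eqP; apply: gap => //; rewrite pqE.
exists (g *m (p - q)); last first.
  by exists (h p - h q) => //; exists (h p); [exists p|exists (h q) => //; exists q].
exists (p - q) => //; exists (patch T (translate P q)); first by exists q.
apply/patchE; split; first by exists p.
rewrite (le_lt_trans (gC _))// ltr_pM2l//.
have -> : g *m (p - q) = (phi p - phi q) - (h p - h q) by rewrite pqE addrK.
have := enormD (phi p - phi q) (- (h p - h q)).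
have := enormD (h p) (- h q); rewrite !enormN.
have := hM p; have := hM q; lra.
Qed.

Lemma image_relatively_dense M : (forall x, enorm (h x) <= M) ->
  relatively_dense (phi @` P).
Proof.
move=> hM; have [r0 r0_gt0 dense] := relatively_denseP delP.2.
have [C C0 gC] := mulmx_enorm_bounded g.
exists (C * r0 + M) => x; have [p Pp px] := dense (invmx g *m x).
exists (phi p - x); apply/patchE; split; first by exists (phi p) => //; exists p.
have -> : phi p - x = g *m (p - invmx g *m x) + h p.
  by rewrite mulmxBr mulKVmx// phiE addrAC.
rewrite (le_lt_trans (enormD _ _))// ltr_leD// (le_lt_trans (gC _))//.
by rewrite ltr_pM2l.
Qed.

End DeloneImage.

(** * The induced map of hulls *)

Section Orbit.
Context {R : realType} {n : nat} {P : set 'cV[R]_n}.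

Lemma orb_inj (A B : orb P) : sval A = sval B -> A = B.
Proof. by case: A B => [A hA] [B hB]/= AB; exact: eq_exist. Qed.

Lemma orb_ptP (A : orb P) : exists x, A = orb_pt P x.
Proof.
have [x _ xA] := set_mem (svalP A).
by exists x; apply: orb_inj; rewrite /= xA.
Qed.

Lemma orb_shift_pt x y : orb_shift (orb_pt P x) y = orb_pt P (x + y).
Proof. by apply: orb_inj; rewrite /= translateD. Qed.

Lemma orb_base_pt : orb_base P = orb_pt P 0.
Proof. by apply: orb_inj; rewrite /= translate0. Qed.

End Orbit.

Section HullMap.
Context {R : realType} {n : nat}.
Notation V := ('cV[R]_n).
Variables (P : set V) (phi : V -> V) (g : 'M[R]_n).
Hypotheses (delP : Delone P) (flcP : finite_local_complexity P).
Hypothesis g_unit : g \in unitmx.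
Hypothesis wh : weakly_equivariant P (fun x => phi x - g *m x).
Variables (OmP : hull P) (OmQ : hull (phi @` P)).

Let P_ne : P !=set0.
Proof. by have [r _ /(_ 0)[p]] := relatively_denseP delP.2; exists p. Qed.

Let Q_ne : phi @` P !=set0.
Proof. by have [p Pp] := P_ne; exists (phi p), p. Qed.

(** Some [x] with [A = P - x] exists by [orb_ptP]; by [orb_map_pt] the choice
    of [x] does not matter. *)
Definition orb_map (A : orb P) : OmQ :=
  hull_in OmQ (orb_pt (phi @` P) (g *m xget 0 [set x | A = orb_pt P x])).

Lemma orb_map_unif : orb_unif_continuous orb_map.
Proof.
move=> e e0; have e20 : 0 < e / 2 by rewrite divr_gt0.
have [delta d0 PQ] := image_hull_dist delP flcP g_unit wh e20.
exists delta => // A B AB; rewrite /hull_in completion_isometry/=.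
apply: (@le_lt_trans _ _ (e / 2)); last lra.
apply: PQ; move: AB.
have repE (C : orb P) : sval C = translate P (xget 0 [set x | C = orb_pt P x]).
  by have {1}-> := @xgetPex _ 0 [set x | C = orb_pt P x] (orb_ptP C).
by rewrite [in sval A]repE [in sval B]repE.
Qed.

(** Well-definedness is the case of distance [0] of the uniform continuity. *)
Lemma orb_map_pt x :
  orb_map (orb_pt P x) = hull_in OmQ (orb_pt (phi @` P) (g *m x)).
Proof.
apply: mdist_positivity; apply/eqP; rewrite eq_le mdist_ge0 andbT.
apply/ler_addgt0Pl => e e0; rewrite addr0.
have [delta d0 PQ] := image_hull_dist delP flcP g_unit wh e0.
rewrite /hull_in completion_isometry/=; apply: PQ.
have -> : translate P (xget 0 [set y | orb_pt P x = orb_pt P y]) = translate P x.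
  have xE : [set y | orb_pt P x = orb_pt P y]
      (xget 0 [set y | orb_pt P x = orb_pt P y]) by apply: xgetPex; exists x.
  exact/esym/(congr1 sval xE).
have := completion_isometry OmP (orb_pt P x) (orb_pt P x).
by rewrite mdistxx/= => <-.
Qed.

(** The pullback to the vectors [x] of the neighbourhoods of [w'] is a proper filter,
    since the orbit of [phi(P)] is dense and [g] is onto; along an ultrafilter finer
    than it, [P - x] converges to a preimage of [w']. *)
Lemma hull_map_surjective (F : OmP -> OmQ) : continuous F ->
  (forall x, F (hull_in OmP (orb_pt P x)) =
             hull_in OmQ (orb_pt (phi @` P) (g *m x))) ->
  forall w', exists w, F w = w'.
Proof.
move=> cF Fpt w'; pose qpt x := hull_in OmQ (orb_pt (phi @` P) (g *m x)).
have PG : ProperFilter (filter_from (nbhs w') (fun U => qpt @^-1` U)).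
  apply: filter_from_proper; first apply: filter_from_filter.
  - by exists setT; exact: filterT.
  - by move=> A B wA wB; exists (A `&` B) => //; exact: filterI.
  - move=> U w'U.
    have [B UB] := @filter_ex _ _ (trace_proper w') _ (completion_in_cvg_trace w'U).
    have [z Bz] := orb_ptP B; exists (invmx g *m z).
    by rewrite /preimage/= /qpt mulKVmx// -Bz.
have [G [UG subG]] := ultraFilterLemma PG.
have [w Gw] := orbit_ultra_cvg delP.2 flcP OmP UG.
have qw' : qpt @ G --> w' by move=> U w'U; apply: subG; exists U.
have Fw : qpt @ G --> F w.
  have -> : qpt = F \o (fun x => hull_in OmP (orb_pt P x)).
    by apply/funext => x; rewrite /= Fpt.
  by move=> U /cF/Gw.
by exists w; exact: (cvg_unique (@metric_hausdorff _ _) Fw qw').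
Qed.

End HullMap.

Theorem theorem4p13 (R : realType) (n : nat) (P : set 'cV[R]_n)
  (phi : 'cV[R]_n -> 'cV[R]_n) (g : 'M[R]_n)
  (HDelone : Delone P) (HFLC : finite_local_complexity P)
  (Hphi : continuous phi) (Hg : g \in unitmx)
  (Hweak : weakly_equivariant P (fun x => phi x - g *m x))
  (OmP : hull P) (OmQ : hull (phi @` P)) :
  (exists Phi : orb P -> OmQ,
    [/\ forall x : 'cV[R]_n,
          Phi (orb_pt P x) = hull_in OmQ (orb_pt (phi @` P) (g *m x)),
        orb_unif_continuous Phi
      & exists PhiHat : OmP -> OmQ,
        [/\ continuous PhiHat,
            forall A : orb P, PhiHat (hull_in OmP A) = Phi A,
            forall (w : OmP) (x : 'cV[R]_n),
              PhiHat (hull_act w x) = hull_act (PhiHat w) (g *m x)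
          & g = 1%:M ->
              semi_conjugacy PhiHat /\
              PhiHat (hull_in OmP (orb_base P)) =
                hull_in OmQ (orb_base (phi @` P))]])
  /\ (strongly_equivariant P (fun x => phi x - g *m x) -> Delone (phi @` P)).
Proof.
have P_ne : P !=set0.
  by have [r _ /(_ 0)[p]] := relatively_denseP HDelone.2; exists p.
have Q_ne : phi @` P !=set0 by have [p Pp] := P_ne; exists (phi p), p.
split=> [|strong]; last first.
  have [M hM] := weakly_equivariant_bounded HDelone.2 HFLC Hweak.
  split; first exact: image_uniformly_discrete HDelone HFLC Hg M hM strong.
  exact: image_relatively_dense HDelone Hg M hM.
pose Phi : orb P -> OmQ := orb_map g OmQ.
have Phi_unif : orb_unif_continuous Phi := orb_map_unif HDelone HFLC Hg Hweak OmQ.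
have Phi_pt x : Phi (orb_pt P x) = hull_in OmQ (orb_pt (phi @` P) (g *m x)).
  exact: orb_map_pt HDelone HFLC Hg Hweak OmP OmQ x.
exists Phi; split=> //.
have /choice[PhiHat PhiHat_lim] := @unif_cvg_trace _ _ _ _ _ OmP OmQ Phi Phi_unif.
have PhiHat_cont : continuous PhiHat.
  exact: (@unif_lim_continuous _ _ _ _ _ _ _ _ Phi_unif _ PhiHat_lim).
have PhiHat_in A : PhiHat (hull_in OmP A) = Phi A.
  exact: (@unif_lim_extends _ _ _ _ _ _ _ _ Phi_unif _ PhiHat_lim A).
have PhiHat_act w x : PhiHat (hull_act w x) = hull_act (PhiHat w) (g *m x).
  suff /(congr1 (@^~ w)) : (fun v => PhiHat (hull_act v x)) =
    (fun v => hull_act (PhiHat v) (g *m x)) by [].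
  have cPx := @hull_act_continuous _ _ _ P_ne OmP x.
  have cQx := @hull_act_continuous _ _ _ Q_ne OmQ (g *m x).
  apply: continuous_eq_on_completion.
  - by move=> v; exact: continuous_comp (cPx v) (PhiHat_cont _).
  - by move=> v; exact: continuous_comp (PhiHat_cont v) (cQx _).
  move=> A; have [y ->] := orb_ptP A.
  rewrite -/(hull_in OmP (orb_pt P y)) hull_act_in// orb_shift_pt !PhiHat_in.
  by rewrite !Phi_pt hull_act_in// orb_shift_pt mulmxDr.
exists PhiHat; split=> // g1; split; last first.
  by rewrite !orb_base_pt PhiHat_in Phi_pt mulmx0.
split=> //; last by move=> w x; rewrite PhiHat_act g1 mul1mx.
apply: (hull_map_surjective HDelone HFLC Hg PhiHat_cont) => x.
by rewrite PhiHat_in Phi_pt.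
Qed.
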